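(* $\mathrm{LDer}(\mathfrak{m}_2)=\mathrm{BLDer}(\mathfrak{m}_2)=\mathrm{Der}(\mathfrak{m}_2)$; that is, for linear maps $\mathfrak{m}_2\to\mathfrak{m}_2$, the local derivations, the ($\mathbb{F}$-linear) 2-local derivations, and the derivations coincide.
   Context: The ground field $\mathbb{F}$ is algebraically closed of characteristic zero. $\mathfrak{m}_2$ is the $\mathbb{N}$-graded Lie algebra over $\mathbb{F}$ with basis $\{e_i\mid i\geq 1\}$, $e_i$ homogeneous of degree $i$, whose only non-trivial brackets (up to skew-symmetry) are $[e_1,e_i]=e_{i+1}$ for all $i\geq 2$ and $[e_2,e_j]=e_{j+2}$ for all $j\geq 3$. For a Lie algebra $\mathfrak{g}$: a derivation is a linear map $D:\mathfrak{g}\to\mathfrak{g}$ with $D([x,y])=[D(x),y]+[x,D(y)]$ for all $x,y\in\mathfrak{g}$; $\mathrm{Der}(\mathfrak{g})$ is the set of derivations. A local derivation is a linear map $\Delta:\mathfrak{g}\to\mathfrak{g}$ such that for every $x\in\mathfrak{g}$ there is a derivation $D_x$ of $\mathfrak{g}$ (depending on $x$) with $\Delta(x)=D_x(x)$; $\mathrm{LDer}(\mathfrak{g})$ is the set of local derivations. A 2-local derivation is here a linear map $\Delta:\mathfrak{g}\to\mathfrak{g}$ such that for every $x,y\in\mathfrak{g}$ there is a derivation $D_{x,y}$ of $\mathfrak{g}$ (depending on $x,y$) with $\Delta(x)=D_{x,y}(x)$ and $\Delta(y)=D_{x,y}(y)$; $\mathrm{BLDer}(\mathfrak{g})$ is the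 set of 2-local derivations (linearity is part of the definition). *)

(* Defs.v *)
From HB Require Import structures.
From mathcomp Require Import all_boot all_order all_algebra.
From mathcomp Require Import classical_sets.

Set Implicit Arguments.
Unset Strict Implicit.
Unset Printing Implicit Defensive.
Import GRing.Theory.
Local Open Scope ring_scope.
Local Open Scope classical_set_scope.

HB.mixin Record Lmodule_isLieAlgebra (F : fieldType) (L : Type)
    of GRing.Lmodule F L := {
  lie : L -> L -> L;
  lie_linearl : forall y, linear (fun x => lie x y);
  lie_linearr : forall x, linear (fun y => lie x y);
  liexx : forall x, lie x x = 0;
  lie_jacobi : forall x y z,
    lie x (lie y z) + lie y (lie z x) + lie z (lie x y) = 0
}.

#[short(type="lieAlgType")]
HB.structure Definition LieAlgebra (F : fieldType) :=
  {L of GRing.Lmodule F L & Lmodule_isLieAlgebra F L}.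

Section Derivations.
Variables (F : fieldType) (L : lieAlgType F).

Definition Der : set {linear L -> L} :=
  [set D : {linear L -> L} | forall x y, D (lie x y) = lie (D x) y + lie x (D y)].

Definition LDer : set {linear L -> L} :=
  [set Delta : {linear L -> L} | forall x,
    exists2 D : {linear L -> L}, Der D & Delta x = D x].

Definition BLDer : set {linear L -> L} :=
  [set Delta : {linear L -> L} | forall x y,
    exists2 D : {linear L -> L}, Der D & Delta x = D x /\ Delta y = D y].

End Derivations.

Arguments Der {F} L.
Arguments LDer {F} L.
Arguments BLDer {F} L.

(* The underlying vector space of m_2 is that of {poly F}, i.e. the finitely
   supported coefficient sequences, with the monomial 'X^i playing the role of
   e_{i+1}.  The alias carries only the vector space structure: the product of
   polynomials plays no role. *)
Definition m2 (F : fieldType) : Type := {poly F}.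
HB.instance Definition _ (F : fieldType) := GRing.Lmodule.on (m2 F).

Section M2.
Variable F : fieldType.
Implicit Types (i j : nat) (x y z : m2 F).

(* The basis is e_1, e_2, and so on; index 0 is a dummy.  That it is a basis,
   with coordinate functions m2coef, follows from m2coef_linear, m2coefE and
   m2_decomp. *)
Definition m2e i : m2 F := if i is k.+1 then 'X^k : {poly F} else 0.

Definition m2coef x i : F := if i is k.+1 then (x : {poly F})`_k else 0.

Definition m2bound x : nat := size (x : {poly F}).

(* The structure constants: m2table i j is [e_i, e_j] for i, j >= 1. *)
Definition m2table i j : m2 F :=
  if (i == 1)%N && (2 <= j)%N then m2e j.+1
  else if (j == 1)%N && (2 <= i)%N then - m2e i.+1
  else if (i == 2)%N && (3 <= j)%N then m2e j.+2
  else if (j == 2)%N && (3 <= i)%N then - m2e i.+2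
  else 0.

Definition m2lie x y : m2 F :=
  \sum_(1 <= i < (m2bound x).+1) \sum_(1 <= j < (m2bound y).+1)
    (m2coef x i * m2coef y j) *: m2table i j.

Arguments m2e : simpl never.

Lemma m2coef_linear i : linear (fun x => m2coef x i : F^o).
Proof.
move=> a x y; case: i => [|k] /=; first by rewrite scaler0 addr0.
by rewrite /m2coef coefD coefZ.
Qed.

Lemma m2coefE i j : (0 < i)%N -> m2coef (m2e i) j = (i == j)%:R.
Proof.
by case: i j => [|i] [|j] // _; rewrite /m2coef /m2e /= coefXn eqSS eq_sym.
Qed.

Lemma m2coef_ge x i : (m2bound x < i)%N -> m2coef x i = 0.
Proof. by case: i => // k; rewrite ltnS => h; rewrite /m2coef nth_default. Qed.

Lemma m2_decomp x :
  x = \sum_(1 <= i < (m2bound x).+1) m2coef x i *: m2e i.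
Proof.
rewrite big_add1 /= big_mkord /m2coef /m2e /m2bound.
by rewrite -[LHS](@coefK F x) poly_def.
Qed.

Lemma m2coef_inj x y : (forall i, (0 < i)%N -> m2coef x i = m2coef y i) -> x = y.
Proof. by move=> h; apply/polyP => k; apply: (h k.+1). Qed.

Lemma m2sum_trunc (f : nat -> m2 F) m n : (m <= n)%N ->
  (forall i, (m < i)%N -> f i = 0) ->
  \sum_(1 <= i < m.+1) f i = \sum_(1 <= i < n.+1) f i.
Proof.
move=> le_mn f0; rewrite [RHS](big_cat_nat (n := m.+1)) //=.
have -> : \sum_(m.+1 <= i < n.+1) f i = 0; last by rewrite addr0.
by rewrite big_nat big1 // => i /andP[/f0].
Qed.

Lemma m2lie_wide n x y : (m2bound x <= n)%N -> (m2bound y <= n)%N ->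
  m2lie x y = \sum_(1 <= i < n.+1) \sum_(1 <= j < n.+1)
    (m2coef x i * m2coef y j) *: m2table i j.
Proof.
move=> hx hy; rewrite /m2lie (m2sum_trunc hx) => [|i hi]; last first.
  by rewrite big1 // => j _; rewrite m2coef_ge // mul0r scale0r.
apply: eq_bigr => i _; rewrite (m2sum_trunc hy) // => j hj.
by rewrite [m2coef y j]m2coef_ge // mulr0 scale0r.
Qed.

Lemma m2lie_linearl y : linear (fun x => m2lie x y).
Proof.
move=> a x z; set n := maxn (m2bound (a *: x + z))
  (maxn (m2bound x) (maxn (m2bound y) (m2bound z))).
rewrite !(@m2lie_wide n) ?leq_max ?leqnn ?orbT //.
rewrite scaler_sumr -big_split; apply: eq_bigr => i _ /=.
rewrite scaler_sumr -big_split; apply: eq_bigr => j _ /=.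
by rewrite m2coef_linear mulrDl scalerDl scalerA mulrA.
Qed.

Lemma m2tableC i j : m2table i j = - m2table j i.
Proof.
by case: i j => [|[|[|i]]] [|[|[|j]]]; rewrite /m2table /= ?oppr0 ?opprK.
Qed.

Lemma m2lieC x y : m2lie x y = - m2lie y x.
Proof.
set n := maxn (m2bound x) (m2bound y).
rewrite !(@m2lie_wide n) ?leq_max ?leqnn ?orbT //.
rewrite exchange_big -sumrN; apply: eq_bigr => i _ /=.
rewrite -sumrN; apply: eq_bigr => j _ /=.
by rewrite m2tableC scalerN mulrC.
Qed.

Lemma m2lie_linearr x : linear (fun y => m2lie x y).
Proof.
move=> a y z; rewrite m2lieC m2lie_linearl opprD -scalerN.
by rewrite -!(m2lieC x).
Qed.

Lemma m2lie_e i j : (0 < i)%N -> (0 < j)%N -> m2lie (m2e i) (m2e j) = m2table i j.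
Proof.
move=> i0 j0; have he k : (0 < k)%N -> m2bound (m2e k) = k.
  by case: k => // k _; rewrite /m2bound /m2e size_polyXn.
rewrite (@m2lie_wide (maxn i j)) ?he ?leq_maxl ?leq_maxr //.
rewrite (bigD1_seq i) ?iota_uniq //=; last first.
  by rewrite mem_index_iota i0 ltnS leq_maxl.
rewrite (bigD1_seq j) ?iota_uniq //=; last first.
  by rewrite mem_index_iota j0 ltnS leq_maxr.
rewrite !m2coefE // !eqxx mulr1 scale1r.
rewrite big1 => [|k kj]; last first.
  by rewrite !m2coefE // [j == k]eq_sym (negbTE kj) mulr0 scale0r.
rewrite big1 => [|k ki]; first by rewrite !addr0.
rewrite big1 // => l _.
by rewrite m2coefE // [i == k]eq_sym (negbTE ki) mul0r scale0r.
Qed.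

Lemma m2lie0r x : m2lie x 0 = 0.
Proof.
by rewrite -[X in m2lie x X](addNr x) -scaleN1r m2lie_linearr scaleN1r addNr.
Qed.

Lemma m2lieNr x y : m2lie x (- y) = - m2lie x y.
Proof. by rewrite -[- y]addr0 -scaleN1r m2lie_linearr scaleN1r m2lie0r addr0. Qed.

Lemma m2_ind (P : m2 F -> Prop) :
  (forall a x y, P x -> P y -> P (a *: x + y)) ->
  (forall i, (0 < i)%N -> P (m2e i)) -> forall x, P x.
Proof.
move=> PD Pe x; have P0 : P 0.
  by rewrite -[0](addNr (m2e 1)) -scaleN1r; apply: PD; apply: Pe.
rewrite (m2_decomp x) big_nat_cond.
elim/big_rec: _ => // i y /andP[/andP[i0 _] _].
by apply: PD; apply: Pe.
Qed.

Lemma m2liexx x : m2lie x x = 0.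
Proof.
elim/m2_ind: x => [a x y hx hy | i i0]; last first.
  by rewrite m2lie_e //; case: i i0 => [|[|[|i]]].
rewrite m2lie_linearr !m2lie_linearl hx hy scaler0 add0r addr0.
by rewrite (m2lieC x) scalerN subrr.
Qed.

Lemma m2lie_jacobi x y z :
  m2lie x (m2lie y z) + m2lie y (m2lie z x) + m2lie z (m2lie x y) = 0.
Proof.
pose J u v w :=
  m2lie u (m2lie v w) + m2lie v (m2lie w u) + m2lie w (m2lie u v).
have JC u v w : J u v w = J v w u by rewrite /J -addrA addrC.
have JP a u u' v w : J u v w = 0 -> J u' v w = 0 -> J (a *: u + u') v w = 0.
  move=> h h'; have -> : J (a *: u + u') v w = a *: J u v w + J u' v w.
    rewrite /J !m2lie_linearl !m2lie_linearr !scalerDr.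
    by rewrite [RHS]addrACA; congr (_ + _); rewrite addrACA.
  by rewrite h h' scaler0 addr0.
rewrite -/(J x y z).
elim/m2_ind: x => [a x x' | i i0]; first exact: JP.
rewrite JC; elim/m2_ind: y => [a y y' | j j0]; first exact: JP.
rewrite JC; elim/m2_ind: z => [a z z' | k k0]; first exact: JP.
rewrite /J !m2lie_e //.
case: i j k i0 j0 k0 => [|[|[|i]]] [|[|[|j]]] [|[|[|k]]] //= _ _ _;
  rewrite /m2table /= ?m2lieNr ?m2lie0r ?m2lie_e // /m2table /=;
  by rewrite ?oppr0 ?opprK ?addr0 ?add0r ?subrr ?addNr.
Qed.

HB.instance Definition _ :=
  Lmodule_isLieAlgebra.Build F (m2 F) m2lie_linearl m2lie_linearr
    m2liexx m2lie_jacobi.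

Lemma lie_m2e i j : (0 < i)%N -> (0 < j)%N ->
  lie (m2e i) (m2e j) = m2table i j.
Proof. exact: m2lie_e. Qed.

End M2.

(* Main.v *)
(* Elements of m_2 are polynomials, with e_i corresponding to 'X^(i-1).  A
   derivation D is determined by A = D e_1 and B = D e_2, where A_1 = B_0 = 0
   and B_1 = 2 A_0, and
     'X * D 'X^n = 'X^n * (B - 'X * A + n A_0 'X)   for n >= 2.
   Subtracting derivations from a local derivation Delta, one may assume that
   Delta e_1 = 0 and that Delta e_2 is a multiple b e_2; locality at e_1 + e_2
   gives b = 0.  For r != 0 and n >= 2, put x = r^n - r^(n-1) 'X + 'X^n.  Then
   Delta 'X^n = Delta x = D x for some derivation D; comparing constant terms
   gives A_0 = 0, and then the formula above shows that D x vanishes at r.  So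
   Delta 'X^n vanishes at all r != 0, hence is zero. *)
From HB Require Import structures.
Require Import Defs.
From mathcomp Require Import all_boot all_order all_algebra.
From mathcomp Require Import classical_sets.
From mathcomp Require Import ring.

Import GRing.Theory.
Local Open Scope ring_scope.
Local Open Scope classical_set_scope.

(** * Differences of derivations in an arbitrary Lie algebra *)

Section Derivations.
Set Implicit Arguments.
Unset Strict Implicit.
Variables (F : fieldType) (L : lieAlgType F).
Implicit Types D E : {linear L -> L}.

Lemma lieBl (x y z : L) : lie (x - y) z = lie x z - lie y z.
Proof. by rewrite addrC -scaleN1r lie_linearl scaleN1r addrC. Qed.

Lemma lieBr (x y z : L) : lie x (y - z) = lie x y - lie x z.
Proof. by rewrite addrC -scaleN1r lie_linearr scaleN1r addrC. Qed.

Lemma Der_sub D E : Der L D -> Der L E -> Der L (D \- E).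
Proof.
by move=> dD dE x y /=; rewrite dD dE lieBl lieBr opprD addrACA.
Qed.

(** Together with [LDer_sub], this lets a local derivation be reduced modulo derivations before it
    is shown to be one. *)
Lemma Der_subK D E : Der L E -> Der L (D \- E) -> Der L D.
Proof.
move=> dE dDE x y; have /= := dDE x y.
by rewrite dE lieBl lieBr addrACA -opprD => /addIr.
Qed.

Lemma LDer_sub D E : LDer L D -> Der L E -> LDer L (D \- E).
Proof.
move=> lD dE x; have [D' dD' Dx] := lD x.
by exists (D' \- E); [exact: Der_sub | rewrite /= Dx].
Qed.

Lemma Der_sub_BLDer : Der L `<=` BLDer L.
Proof. by move=> D dD x y; exists D. Qed.

Lemma BLDer_sub_LDer : BLDer L `<=` LDer L.
Proof. by move=> D bD x; have [E dE []] := bD x x; exists E. Qed.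

End Derivations.

(** * The bracket of m_2 on polynomials *)

Section M2.
Set Implicit Arguments.
Unset Strict Implicit.
Variable F : fieldType.
Implicit Types (p q c : {poly F}) (D : {linear m2 F -> m2 F}).

(** Closed form of the bracket of m_2: e_1 acts as ['X] and e_2 as ['X^2]. Removing constant terms
    in the second summand keeps [e_1, e_2] from being counted twice. *)
Definition polylie p q : {poly F} :=
  'X * (p`_0 *: q - q`_0 *: p) +
  'X^2 * (p`_1 *: (q - (q`_0)%:P) - q`_1 *: (p - (p`_0)%:P)).

Lemma lie_polylie p q : lie (p : m2 F) (q : m2 F) = polylie p q.
Proof.
rewrite /polylie; elim/(@m2_ind F): p => [a x x' hx hx'|i i0].
  rewrite lie_linearl [LHS](congr2 (fun u v : {poly F} => a *: u + v) hx hx').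
  by rewrite !coefD !coefZ -!mul_polyC !polyCD !polyCM; ring.
elim/(@m2_ind F): q => [a y y' hy hy'|j j0].
  rewrite lie_linearr [LHS](congr2 (fun u v : {poly F} => a *: u + v) hy hy').
  by rewrite !coefD !coefZ -!mul_polyC !polyCD !polyCM; ring.
rewrite lie_m2e //.
case: i j i0 j0 => [|[|[|i]]] [|[|[|j]]] //= _ _;
  rewrite /m2table /m2e /= ?coefXn /= -!mul_polyC ?polyC1 ?polyC0 ?exprS ?expr0;
  ring.
Qed.

Lemma polylie1r q : q`_0 = 0 -> polylie 1 q = 'X * q.
Proof.
move=> q0; rewrite /polylie q0 !coef1 /= -!mul_polyC polyC1 polyC0; ring.
Qed.

Lemma polylieXr q : q`_0 = 0 -> polylie 'X q = 'X^2 * (q - q`_1 *: 'X).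
Proof.
move=> q0; rewrite /polylie q0 !coefX /= -!mul_polyC polyC1 polyC0; ring.
Qed.

Lemma polylieXnr p n :
  polylie p 'X^(n.+2) = (p`_0 *: 'X + p`_1 *: 'X^2) * 'X^(n.+2).
Proof. rewrite /polylie !coefXn /= -!mul_polyC polyC0; ring. Qed.

Lemma Der_polylie D p q : Der (m2 F) D ->
  D (polylie p q : m2 F) = polylie (D p) q + polylie p (D q) :> {poly F}.
Proof. by move=> dD; rewrite -lie_polylie dD !lie_polylie. Qed.

(* For c = 'X^k, the outer derivation e_1 |-> 0, e_j |-> e_(j+k) for j >= 2. *)
Definition shift_der c (x : m2 F) : m2 F := c * (x - ((x : {poly F})`_0)%:P).

Lemma shift_der_linear c : linear (shift_der c).
Proof.
move=> a p q; suff : shift_der c (a *: p + q) =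
  a *: (shift_der c p : {poly F}) + (shift_der c q : {poly F}) :> {poly F} by [].
by rewrite /shift_der coefD coefZ polyCD polyCM -!mul_polyC; ring.
Qed.

HB.instance Definition _ c :=
  GRing.isLinear.Build F (m2 F) (m2 F) _ (shift_der c) (shift_der_linear c).

(** As c_0 = 0, the image lies in the span of the e_j with j >= 3. There the bracket with p is
    multiplication by p_0 ['X] + p_1 ['X^2], which commutes with multiplication by c. *)
Lemma shift_der_Der c : c`_0 = 0 -> Der (m2 F) (shift_der c).
Proof.
move=> c0 p q; suff : shift_der c (polylie p q) =
    polylie (shift_der c p) q + polylie p (shift_der c q) :> {poly F}.
  by rewrite -!lie_polylie.
have coefS0 x : (shift_der c x)`_0 = 0.
  by rewrite /shift_der coefM big_ord1 c0 mul0r.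
have coefS1 x : (shift_der c x)`_1 = 0.
  rewrite /shift_der coefM !big_ord_recl big_ord0 /= c0 mul0r.
  by rewrite coefB coefC subrr mulr0 !addr0.
have lie0 : (polylie p q)`_0 = 0.
  by rewrite /polylie coefD coefXM coefXnM /= addr0.
rewrite {1}/shift_der lie0 /polylie !coefS0 !coefS1 /shift_der.
rewrite -!mul_polyC polyC0; ring.
Qed.

(** * Derivations of m_2 computed from their values on e_1 and e_2 *)

Section Derivation.
Variable D : {linear m2 F -> m2 F}.
Hypothesis dD : Der (m2 F) D.
Let A : {poly F} := D (1 : {poly F}).
Let B : {poly F} := D ('X : {poly F}).

Let DX2 : D ('X^2 : {poly F}) =
  'X * (A`_0 *: 'X + B - (B`_0)%:P) - 'X^2 * (A - (A`_0)%:P - A`_1 *: 'X) :> {poly F}.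
Proof.
have -> : 'X^2 = polylie 1 'X :> {poly F} by rewrite polylie1r ?coefX.
rewrite Der_polylie // -/A -/B /polylie !coefX !coef1 /= -!mul_polyC.
by rewrite !polyC1 polyC0; ring.
Qed.

Let DXS n : (D ('X^(n.+2) : {poly F}) : {poly F})`_0 = 0 -> D ('X^(n.+3) : {poly F}) =
  (A`_0 *: 'X + A`_1 *: 'X^2) * 'X^(n.+2) + 'X * (D ('X^(n.+2) : {poly F}) : {poly F})
  :> {poly F}.
Proof.
move=> h; have -> : 'X^(n.+3) = polylie 1 'X^(n.+2) :> {poly F}.
  by rewrite polylie1r ?coefXn // exprS.
by rewrite Der_polylie // polylieXnr [polylie 1 _]polylie1r.
Qed.

(* Obtained by comparing D [e_2, e_3] with D [e_1, e_4], as both brackets are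
   e_5. *)
Lemma Der_gen_coef : 2%:R != 0 :> F ->
  [/\ A`_1 = 0, B`_0 = 0 & B`_1 = A`_0 *+ 2].
Proof.
move=> two_neq0.
set P : {poly F} := D ('X^2 : {poly F}).
have P0 : P`_0 = 0 by rewrite /P DX2 coefB coefXM coefXnM /= subr0.
have P1 : P`_1 = 0.
  rewrite /P DX2 coefB coefXM coefXnM /= subr0 coefB coefD coefZ coefX coefC /=.
  by rewrite mulr0 add0r subrr.
have D3 := DXS P0; rewrite -/P in D3.
have D4 : D ('X^4 : {poly F}) =
  (A`_0 *: 'X + A`_1 *: 'X^2) * 'X^3 + 'X * (D ('X^3 : {poly F}) : {poly F})
  :> {poly F}.
  by apply: DXS; rewrite D3 coefD coefXM coefMXn addr0.
have : D ('X^4 : {poly F}) = D (polylie 'X 'X^2) :> {poly F}.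
  by rewrite polylieXr coefXn //= scale0r subr0 -exprD.
rewrite Der_polylie // polylieXnr -/B -/P [polylie 'X _]polylieXr // P1 scale0r subr0.
rewrite D4 D3 => E.
(* Both sides contain ['X^2 * P]. Once it is cancelled, degrees 3, 4 and 5 give B_0 = 0, B_1 = 2 A_0
   and 2 A_1 = 0. *)
have {}E : A`_0 *+ 2 *: 'X^4 + A`_1 *+ 2 *: 'X^5 = B`_0 *: 'X^3 + B`_1 *: 'X^4.
  suff: A`_0 *+ 2 *: 'X^4 + A`_1 *+ 2 *: 'X^5 + 'X^2 * P =
      B`_0 *: 'X^3 + B`_1 *: 'X^4 + 'X^2 * P by move/addIr.
  move: E; rewrite -!mul_polyC !polyCMn => E.
  transitivity (((B`_0)%:P * 'X + (B`_1)%:P * 'X^2) * 'X^2 + 'X^2 * P); last by ring.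
  by rewrite -E; ring.
have coefE k := congr1 (fun p : {poly F} => p`_k) E.
have := coefE 3; have := coefE 4; have := coefE 5.
rewrite !coefD !coefZ !coefXn /= !(mulr0, mulr1, addr0, add0r) => E5 E4 E3.
split=> //; apply/eqP; move/eqP: E5.
by rewrite -mulr_natr mulf_eq0 (negPf two_neq0) orbF.
Qed.

(** By induction on n: one more bracket with e_1 multiplies by ['X] and adds one A_0 ['X] to the
    factor. The ['X] on the left avoids dividing B by ['X]. *)
Lemma Der_Xn n : 2%:R != 0 :> F ->
  'X * (D ('X^(n.+2) : {poly F}) : {poly F}) =
  'X^(n.+2) * (B - 'X * A + A`_0 *+ n.+2 *: 'X).
Proof.
move=> two_neq0; have [A1 B0 _] := Der_gen_coef two_neq0.
elim: n => [|n IH].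
  by rewrite DX2 A1 B0 -!mul_polyC !polyC0 polyCMn; ring.
rewrite DXS.
  rewrite mulrDr IH A1 [in RHS]mulrS; move: (A`_0 *+ n.+2) => t.
  by rewrite -!mul_polyC polyC0 polyCD !(exprS _ n.+2); ring.
have := congr1 (fun p : {poly F} => p`_1) IH.
by rewrite coefXM coefXnM.
Qed.

Lemma Der_Xn_coef0 n : 2%:R != 0 :> F ->
  (D ('X^(n.+2) : {poly F}) : {poly F})`_0 = 0.
Proof.
move=> /(Der_Xn n) /(congr1 (fun p : {poly F} => p`_1)).
by rewrite coefXM coefXnM.
Qed.

End Derivation.

(** * Local derivations of m_2 that kill e_1 *)

Lemma LDer_gen_eq0 D n r : LDer (m2 F) D -> 2%:R != 0 :> F ->
  D (1 : {poly F}) = 0 -> D ('X : {poly F}) = 0 ->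
  r != 0 -> (D ('X^(n.+2) : {poly F}) : {poly F}).[r] = 0.
Proof.
move=> lD two_neq0 D1 DX r_neq0.
(* If A_0 = 0, the value of E ['X^(n.+2)] at r is r^(n+1) (B(r) - r A(r)), and the first two terms
   of x are chosen to cancel it. *)
pose x : {poly F} := r ^+ n.+2 *: 1 - r ^+ n.+1 *: 'X + 'X^(n.+2).
have linE (E : {linear m2 F -> m2 F}) :
    E x = r ^+ n.+2 *: (E (1 : {poly F}) : {poly F}) -
      r ^+ n.+1 *: (E ('X : {poly F}) : {poly F}) +
      (E ('X^(n.+2) : {poly F}) : {poly F}) :> {poly F}.
  rewrite /x; pose u : m2 F := (1 : {poly F}); pose v : m2 F := ('X : {poly F}).
  pose w : m2 F := ('X^(n.+2) : {poly F}).
  rewrite -[LHS]/(E (r ^+ n.+2 *: u - r ^+ n.+1 *: v + w)).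
  by rewrite linearD linearB !linearZ.
have DxE : D ('X^(n.+2) : {poly F}) = D x :> {poly F}.
  rewrite linE D1 DX.
  by rewrite -[RHS]/(r ^+ n.+2 *: 0 - r ^+ n.+1 *: 0 + _) !scaler0 subr0 add0r.
have D0 : (D ('X^(n.+2) : {poly F}) : {poly F})`_0 = 0.
  by have [E dE ->] := lD ('X^(n.+2) : {poly F}); apply: Der_Xn_coef0.
have [E dE Dx] := lD x; rewrite DxE Dx linE in D0 *.
have [_ B0 _] := Der_gen_coef dE two_neq0.
(* The constant term of E x reduces to r^(n+2) A_0, and by [D0] it is zero. *)
have A0 : (E (1 : {poly F}) : {poly F})`_0 = 0.
  apply/eqP; move/eqP: D0; rewrite coefD coefB !coefZ B0 Der_Xn_coef0 //.
  by rewrite mulr0 subr0 addr0 mulf_eq0 expf_eq0 (negPf r_neq0) andbF.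
have := congr1 (fun p : {poly F} => p.[r]) (Der_Xn dE n two_neq0).
rewrite A0 mul0rn scale0r addr0 !hornerE /= => EXn.
apply: (mulfI r_neq0); rewrite mulr0 mulrDr EXn.
by rewrite !exprS; ring.
Qed.

(** Locality at e_1 + e_2 gives A + B = b ['X]; degree 0 yields A_0 = 0, then degree 1 yields b =
    A_1 + B_1 = 2 A_0 = 0. *)
Lemma LDer_DX_eq0 D b : LDer (m2 F) D -> 2%:R != 0 :> F ->
  D (1 : {poly F}) = 0 -> D ('X : {poly F}) = b *: ('X : {poly F}) :> {poly F} ->
  D ('X : {poly F}) = 0.
Proof.
move=> lD two_neq0 D1 DX.
have linE (E : {linear m2 F -> m2 F}) : E (1 + 'X : {poly F}) =
    (E (1 : {poly F}) : {poly F}) + (E ('X : {poly F}) : {poly F}) :> {poly F}.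
  exact: (linearD E (1 : {poly F}) ('X : {poly F})).
have [E dE] := lD (1 + 'X : {poly F}).
rewrite !linE D1 DX -[LHS]/(0 + b *: 'X) add0r => EX.
have [A1 B0 B1] := Der_gen_coef dE two_neq0.
have := congr1 (fun p : {poly F} => p`_0) EX.
rewrite coefD coefZ coefX B0 mulr0 addr0 => A0.
have := congr1 (fun p : {poly F} => p`_1) EX.
rewrite coefD coefZ coefX mulr1 A1 B1 -A0 mul0rn addr0 => b0.
by move: DX; rewrite b0 scale0r.
Qed.

Lemma m2_linear_eq0 D : (forall n, D ('X^n : {poly F}) = 0) ->
  forall x, D x = 0.
Proof.
move=> D0; elim/(@m2_ind F) => [a x y Dx Dy|[//|i] _]; last exact: D0.
by rewrite linearP Dx Dy scaler0 addr0.
Qed.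

End M2.

Lemma poly_horner_eq0 (F : closedFieldType) (p : {poly F}) :
  (forall r, p.[r] = 0) -> p = 0.
Proof.
(* At a root of p + 1 the value of p would be -1, so p + 1 has no root and is constant. *)
move=> p0; have /size1_polyC pE : (size (p + 1)%R <= 1)%N.
  rewrite leq_eqVlt; apply/orP; left; apply: contraT => /closed_rootP[r].
  by rewrite /root hornerD p0 hornerC add0r oner_eq0.
have {}pE : p = ((p + 1)`_0 - 1)%:P by rewrite polyCB -pE addrK.
by move: (p0 0); rewrite pE hornerC => ->.
Qed.

Lemma LDer_gens_eq0 (F : closedFieldType) (D : {linear m2 F -> m2 F}) :
  2%:R != 0 :> F -> LDer (m2 F) D ->
  D (1 : {poly F}) = 0 -> D ('X : {poly F}) = 0 -> forall x, D x = 0.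
Proof.
move=> two_neq0 lD D1 DX; apply: m2_linear_eq0 => -[//|[//|n]].
(* The factor ['X] takes care of r = 0, where [LDer_gen_eq0] does not apply. *)
suff : 'X * (D ('X^(n.+2) : {poly F}) : {poly F}) = 0.
  by move/eqP; rewrite mulf_eq0 polyX_eq0 => /eqP.
apply: poly_horner_eq0 => r; rewrite hornerM hornerX.
have [->|r_neq0] := eqVneq r 0; first by rewrite mul0r.
by rewrite LDer_gen_eq0 ?mulr0.
Qed.

Lemma LDer_kill1_Der (F : closedFieldType) (D : {linear m2 F -> m2 F}) :
  2%:R != 0 :> F -> LDer (m2 F) D -> D (1 : {poly F}) = 0 -> Der (m2 F) D.
Proof.
move=> two_neq0 lD D1.
pose B : {poly F} := D ('X : {poly F}).
have B0 : B`_0 = 0.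
  by have [E dE EX] := lD ('X : {poly F}); rewrite /B EX; case: (Der_gen_coef dE).
(* With this c, c ['X] is B without its terms of degree 0 and 1, so [shift_der c] removes all of D
   e_2 except B_1 e_2. *)
pose c := drop_poly 2 B * 'X.
have dc : Der (m2 F) (shift_der c) by apply: shift_der_Der; rewrite coefMX.
apply: (Der_subK dc); have lDc := LDer_sub lD dc.
have Dc1 : (D \- shift_der c) (1 : {poly F}) = 0.
  by rewrite /= D1 /shift_der coef1 subrr mulr0 subr0.
have DcX : (D \- shift_der c) ('X : {poly F}) = B`_1 *: ('X : {poly F}) :> {poly F}.
  rewrite -[LHS]/(B - c * ('X - ('X`_0)%:P)) coefX subr0 -mulrA -expr2.
  rewrite -{1}(poly_take_drop 2 B) addrK.
  by apply/polyP => -[|[|k]]; rewrite coef_take_poly coefZ coefX /= ?mulr0 ?mulr1.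
have Dc0 := LDer_gens_eq0 two_neq0 lDc Dc1 (LDer_DX_eq0 lDc two_neq0 Dc1 DcX).
by move=> x y; rewrite !Dc0 -(subrr x) lieBl lieBr !subrr addr0.
Qed.

Lemma LDer_sub_Der (F : closedFieldType) :
  2%:R != 0 :> F -> LDer (m2 F) `<=` Der (m2 F).
Proof.
move=> two_neq0 D lD; have [E dE E1] := lD (1 : {poly F}).
apply: (Der_subK dE); apply: (LDer_kill1_Der two_neq0 (LDer_sub lD dE)).
by rewrite /= E1 subrr.
Qed.

Theorem theorem4p3 (F : closedFieldType) (char0 : [pchar F] =i pred0) :
  LDer (m2 F) = BLDer (m2 F) /\ BLDer (m2 F) = Der (m2 F).
Proof.
have two_neq0 : 2%:R != 0 :> F by have /negbT := char0 2; rewrite inE.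
have LD : LDer (m2 F) `<=` Der (m2 F) by exact: LDer_sub_Der.
have DB := @Der_sub_BLDer F (m2 F); have BL := @BLDer_sub_LDer F (m2 F).
split; apply/seteqP; split=> //.
- by move=> D /LD /DB.
- by move=> D /BL /LD.
Qed.
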